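(* For every four-, five-, or six-body co-circular central configuration, the radius $r$ of the circle containing the bodies satisfies $r<r_0$.
   Context: All masses are positive, and the bodies of a configuration occupy pairwise distinct positions. For bodies with masses $m_1,\dots,m_n$ at $\mathbf{q}_1,\dots,\mathbf{q}_n$ put $m=\sum_i m_i$, $c=\frac1m\sum_i m_i\mathbf{q}_i$, $U=\sum_{i<j}\frac{m_im_j}{|\mathbf{q}_i-\mathbf{q}_j|}$, $I=\sum_i m_i|\mathbf{q}_i-c|^2$. The configuration is central if $\nabla U+\frac{\lambda}{2}\nabla I=0$ with $\lambda=U/I$, i.e. $\sum_{j\ne i} m_im_j\frac{\mathbf{q}_j-\mathbf{q}_i}{|\mathbf{q}_j-\mathbf{q}_i|^3}=-\lambda m_i(\mathbf{q}_i-c)$ for all $i$. It is co-circular if its bodies lie on a common circle. Set $r_0=(m/\lambda)^{1/3}=(mI/U)^{1/3}$. *)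

(* Defs.v *)
From HB Require Import structures.
From mathcomp Require Import all_boot all_order all_algebra.
From mathcomp Require Import reals exp.

Set Implicit Arguments.
Unset Strict Implicit.
Unset Printing Implicit Defensive.

Import Order.TTheory GRing.Theory Num.Theory.

Local Open Scope ring_scope.

(* The norm that MathComp-Analysis attaches to matrices is the sup norm. *)
Definition enorm (R : realType) (x : 'rV[R]_2) : R :=
  Num.sqrt (\sum_(k < 2) x 0 k ^+ 2).

Definition total_mass (R : realType) (n : nat) (m : 'I_n -> R) : R :=
  \sum_(i < n) m i.

Definition center_of_mass (R : realType) (n : nat)
    (m : 'I_n -> R) (q : 'I_n -> 'rV[R]_2) : 'rV[R]_2 :=
  (total_mass m)^-1 *: \sum_(i < n) m i *: q i.

Definition potential (R : realType) (n : nat)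
    (m : 'I_n -> R) (q : 'I_n -> 'rV[R]_2) : R :=
  \sum_(i < n) \sum_(j < n | (i < j)%N) m i * m j / enorm (q i - q j).

Definition inertia (R : realType) (n : nat)
    (m : 'I_n -> R) (q : 'I_n -> 'rV[R]_2) : R :=
  \sum_(i < n) m i * enorm (q i - center_of_mass m q) ^+ 2.

Definition cc_lambda (R : realType) (n : nat)
    (m : 'I_n -> R) (q : 'I_n -> 'rV[R]_2) : R :=
  potential m q / inertia m q.

(* Component i of the equation grad U + (lambda / 2) grad I = 0. *)
Definition central_configuration (R : realType) (n : nat)
    (m : 'I_n -> R) (q : 'I_n -> 'rV[R]_2) : Prop :=
  forall i : 'I_n,
    \sum_(j < n | j != i)
       (m i * m j) *: ((enorm (q j - q i) ^+ 3)^-1 *: (q j - q i)) =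
    - (cc_lambda m q * m i) *: (q i - center_of_mass m q).

Definition on_circle (R : realType) (n : nat)
    (q : 'I_n -> 'rV[R]_2) (o : 'rV[R]_2) (r : R) : Prop :=
  0 < r /\ forall i : 'I_n, enorm (q i - o) = r.

Definition r_zero (R : realType) (n : nat)
    (m : 'I_n -> R) (q : 'I_n -> 'rV[R]_2) : R :=
  powR (total_mass m / cc_lambda m q) 3^-1.

(* Main.v *)
(** Put S_ij = |q_i - q_j|^-3 - r0^-3; the equations of a central configuration
    read sum_j m_j S_ij (q_j - q_i) = 0.  Suppose r0 <= r.  If no body lies
    strictly less than 60 degrees counterclockwise from q_i, then every body with
    S_ij > 0 lies clockwise from q_i, and the chord of length r0 issued clockwise
    from q_i separates the bodies with S_ij > 0 from those with S_ij < 0; hence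
    all S_ij vanish, which is impossible because a circle has at most two points
    at distance r0 from q_i.  So every body is followed counterclockwise, within
    60 degrees, by another one, and six such steps starting from any body visit
    seven distinct bodies. *)
Require Import Defs.
From HB Require Import structures.
From mathcomp Require Import all_boot all_order all_algebra.
From mathcomp Require Import reals exp.
From mathcomp Require Import ring lra zify.

Set Implicit Arguments.
Unset Strict Implicit.
Unset Printing Implicit Defensive.

Import Order.TTheory GRing.Theory Num.Theory.

Local Open Scope ring_scope.

(** * Dot and cross products in the plane *)

Definition dot (R : realType) (a b : 'rV[R]_2) : R :=
  a 0 0 * b 0 0 + a 0 1 * b 0 1.

Definition cross (R : realType) (a b : 'rV[R]_2) : R :=
  a 0 0 * b 0 1 - a 0 1 * b 0 0.

Lemma enorm_ge0 (R : realType) (a : 'rV[R]_2) : 0 <= enorm a.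
Proof. exact: sqrtr_ge0. Qed.

Lemma sqr_enorm (R : realType) (a : 'rV[R]_2) : enorm a ^+ 2 = dot a a.
Proof.
rewrite /enorm sqr_sqrtr; last by apply: sumr_ge0 => k _; exact: sqr_ge0.
rewrite big_ord_recl big_ord1 /dot !expr2.
by have -> : lift ord0 ord0 = 1 :> 'I_2 by apply/val_inj.
Qed.

Lemma rV2_eq (R : realType) (a b : 'rV[R]_2) :
  a 0 0 = b 0 0 -> a 0 1 = b 0 1 -> a = b.
Proof.
move=> e0 e1; apply/rowP => k; case: k => [[|[|k]]] lt_k //.
- by have -> : Ordinal lt_k = 0 by apply/val_inj.
- by have -> : Ordinal lt_k = 1 by apply/val_inj.
Qed.

Lemma dot_self_eq0 (R : realType) (a : 'rV[R]_2) : dot a a = 0 -> a = 0.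
Proof.
rewrite /dot -!expr2 => /eqP; rewrite paddr_eq0 ?sqr_ge0// !sqrf_eq0.
by case/andP => /eqP a0 /eqP a1; apply: rV2_eq; rewrite mxE.
Qed.

Lemma enorm_gt0 (R : realType) (a : 'rV[R]_2) : a != 0 -> 0 < enorm a.
Proof.
move=> a0; rewrite lt_def enorm_ge0 andbT; apply: contraNneq a0 => e0.
by apply/eqP/dot_self_eq0; rewrite -sqr_enorm e0 expr0n.
Qed.

Lemma crossC (R : realType) (a b : 'rV[R]_2) : cross b a = - cross a b.
Proof. by rewrite /cross; ring. Qed.

Lemma cross_self (R : realType) (a : 'rV[R]_2) : cross a a = 0.
Proof. by rewrite /cross; ring. Qed.

Lemma sqr_dot_cross (R : realType) (a b : 'rV[R]_2) :
  dot a b ^+ 2 + cross a b ^+ 2 = dot a a * dot b b.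
Proof. by rewrite /dot /cross; ring. Qed.

(** The addition formula for the sine, with [b] as the intermediate direction; [dot_trans] is the
    one for the cosine. *)
Lemma cross_trans (R : realType) (a b c : 'rV[R]_2) :
  dot b b * cross a c = cross a b * dot b c + dot a b * cross b c.
Proof. by rewrite /dot /cross; ring. Qed.

Lemma dot_trans (R : realType) (a b c : 'rV[R]_2) :
  dot b b * dot a c = dot a b * dot b c - cross a b * cross b c.
Proof. by rewrite /dot /cross; ring. Qed.

Lemma dot_cross_inj (R : realType) (a b c : 'rV[R]_2) :
  0 < dot a a -> dot a b = dot a c -> cross a b = cross a c -> b = c.
Proof.
move=> a0 eD eC; apply/eqP; rewrite -subr_eq0; apply/eqP/dot_self_eq0.
have : dot a a * dot (b - c) (b - c) = 0.
  rewrite -sqr_dot_cross.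
  have -> : dot a (b - c) = dot a b - dot a c by rewrite /dot !mxE; ring.
  have -> : cross a (b - c) = cross a b - cross a c by rewrite /cross !mxE; ring.
  by rewrite eD eC !subrr !expr0n addr0.
by move/eqP; rewrite mulf_eq0 gt_eqF//= => /eqP.
Qed.

(** * Counterclockwise steps of less than 60 degrees *)

(** When [a] and [b] have squared norm [u], the oriented angle from [a] to [b] has positive sine and
    cosine above 1/2, so it lies strictly between 0 and 60 degrees. *)
Definition follows (R : realType) (u : R) (a b : 'rV[R]_2) : Prop :=
  0 < cross a b /\ u / 2 < dot a b.

Lemma follows_cross2 (R : realType) (u : R) (a b c : 'rV[R]_2) :
  0 < u -> dot b b = u -> follows u a b -> follows u b c -> 0 < cross a c.
Proof.
move=> u0 bb [C1 D1] [C2 D2]; rewrite -(pmulr_rgt0 _ u0) -{1}bb cross_trans.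
by apply: addr_gt0; apply: mulr_gt0 => //; lra.
Qed.

(** This is tan < sqrt 3 for the angle of a step, squared and cleared of the denominator. *)
Lemma follows_cross_dot (R : realType) (u : R) (a b : 'rV[R]_2) :
  0 < u -> dot a a = u -> dot b b = u -> follows u a b ->
  cross a b ^+ 2 < 3 * dot a b ^+ 2.
Proof. by move=> u0 aa bb [C0 D0]; have := sqr_dot_cross a b; rewrite aa bb; nra. Qed.

(* With t_i in (0, sqrt 3) the tangents of the three angles,
   t_1 t_2 t_3 < 3 t_k for each k, hence t_1 t_2 t_3 < t_1 + t_2 + t_3. *)
Lemma follows_cross3 (R : realType) (u : R) (a b c d : 'rV[R]_2) :
  0 < u -> dot a a = u -> dot b b = u -> dot c c = u -> dot d d = u ->
  follows u a b -> follows u b c -> follows u c d -> 0 < cross a d.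
Proof.
move=> u0 aa bb cc dd f1 f2 f3.
have t1 := follows_cross_dot u0 aa bb f1.
have t2 := follows_cross_dot u0 bb cc f2.
have t3 := follows_cross_dot u0 cc dd f3.
have e1 := cross_trans a b c; have e2 := dot_trans a b c.
have e3 := cross_trans a c d; rewrite bb in e1 e2; rewrite cc in e3.
case: f1 f2 f3 => [C1 D1] [C2 D2] [C3 D3].
move: (cross a b) (cross b c) (cross c d) (dot a b) (dot b c) (dot c d)
  (cross a c) (dot a c) (cross a d) t1 t2 t3 e1 e2 e3 C1 D1 C2 D2 C3 D3
  => s1 s2 s3 c1 c2 c3 s12 c12 s t1 t2 t3 e1 e2 e3 C1 D1 C2 D2 C3 D3.
have prod (x y z w : R) : 0 < x -> 0 < y -> u / 2 < z -> u / 2 < w ->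
    x ^+ 2 < 3 * z ^+ 2 -> y ^+ 2 < 3 * w ^+ 2 -> x * y < 3 * (z * w).
  move=> x0 y0 z0 w0 xz yw.
  have zw0 : 0 < z * w by apply: mulr_gt0; lra.
  rewrite -(@ltr_pXn2r _ 2) ?nnegrE//; first last.
  - by lra.
  - by rewrite ltW// mulr_gt0.
  rewrite !exprMn (_ : 3 ^+ 2 * _ = (3 * z ^+ 2) * (3 * w ^+ 2)); last by ring.
  by apply: ltr_pM => //; exact: sqr_ge0.
have p12 := prod _ _ _ _ C1 C2 D1 D2 t1 t2.
have p23 := prod _ _ _ _ C2 C3 D2 D3 t2 t3.
have p13 := prod _ _ _ _ C1 C3 D1 D3 t1 t3.
have q12 : s1 * s2 * s3 < 3 * (c1 * c2) * s3 by rewrite ltr_pM2r.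
have q23 : s2 * s3 * s1 < 3 * (c2 * c3) * s1 by rewrite ltr_pM2r.
have q13 : s1 * s3 * s2 < 3 * (c1 * c3) * s2 by rewrite ltr_pM2r.
(* The sine of the sum of the three angles. Adding [q12], [q23] and [q13] shows that its only
   negative term, s1 s2 s3, is outweighed by the other three. *)
have e : u ^+ 2 * s = (s1 * c2 + c1 * s2) * c3 + (c1 * c2 - s1 * s2) * s3.
  by rewrite -e1 -e2 expr2 -mulrA e3; ring.
have u20 : 0 < u ^+ 2 by rewrite exprn_gt0.
by rewrite -(pmulr_rgt0 _ u20) e; lra.
Qed.

Lemma card_follows (R : realType) (n : nat) (p : 'I_n.+1 -> 'rV[R]_2) (u : R) :
  0 < u -> (forall i, dot (p i) (p i) = u) ->
  (forall i, exists j, follows u (p i) (p j)) -> (6 < n.+1)%N.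
Proof.
move=> u0 pu /fin_all_exists [f pf].
pose g k : 'I_n.+1 := iter k f ord0.
have gS k : follows u (p (g k)) (p (g k.+1)) by exact: pf.
(* Up to three steps turn by less than 180 degrees, so the sine stays positive. *)
have short k l : (k < l <= k + 3)%N -> 0 < cross (p (g k)) (p (g l)).
  move=> kl; have : [\/ l = k.+1, l = k.+2 | l = k.+3].
    have [?|?] := ltnP k.+1 l; last by constructor 1; lia.
    have [?|?] := ltnP k.+2 l; last by constructor 2; lia.
    by constructor 3; lia.
  case=> ->; first by case: (gS k).
  - exact: (follows_cross2 u0 (pu _) (gS _) (gS _)).
  - exact: (follows_cross3 u0 (pu _) (pu _) (pu _) (pu _) (gS _) (gS _) (gS _)).
have g_neq k l : (k < l <= k + 6)%N -> g k != g l.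
  move=> kl; apply/eqP => e.
  have [l3|l3] := leqP l (k + 3).
    by have := short k l; rewrite e cross_self ltxx; lia.
  (* If steps [k] and [l] met at one body, body [g (k + 3)] would be less than 180 degrees
     counterclockwise from it and also less than 180 degrees clockwise. *)
  have : 0 < cross (p (g k)) (p (g (k + 3))) by apply: short; lia.
  have : 0 < cross (p (g (k + 3))) (p (g l)) by apply: short; lia.
  by rewrite -e crossC; lra.
have g_inj : injective (fun k : 'I_7 => g k).
  move=> k l e; apply/val_inj; have := ltn_ord k; have := ltn_ord l.
  have := g_neq k l; have := g_neq l k; rewrite e eqxx /=; lia.
by have := leq_card _ g_inj; rewrite !card_ord.
Qed.

(** * The chord of length r0 and the existence of a follower *)

(* For p_i = (sqrt u, 0), the chord ends at (c, - s) / sqrt u and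
   p_j = (D, C) / sqrt u. *)
Lemma chord_side (R : realType) (u c s C D : R) :
  0 < s -> c < u -> D < u -> s ^+ 2 + c ^+ 2 = u ^+ 2 -> D ^+ 2 + C ^+ 2 = u ^+ 2 ->
  C < 0 -> exists2 k, 0 < k & (u - c) * C + s * (u - D) = k * (c - D).
Proof.
(* [h] is the conjugate of the left-hand side: their product is a difference of squares, and
   replacing s^2 by (u - c)(u + c) and C^2 by (u - D)(u + D) leaves 2 u (u - c)(u - D)(c - D). *)
move=> s0 cu Du sc DC C0; pose h := s * (u - D) - (u - c) * C.
have h0 : 0 < h.
  have t1 : 0 < s * (u - D) by apply: mulr_gt0; lra.
  have t2 : 0 < (u - c) * - C by apply: mulr_gt0; lra.
  by rewrite /h; lra.
have u0 : 0 < u by nra.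
exists (2 * u * (u - c) * (u - D) / h).
  by rewrite divr_gt0// !mulr_gt0//; lra.
have h_neq0 : h != 0 by rewrite gt_eqF.
apply: (mulIf h_neq0).
transitivity (s ^+ 2 * (u - D) ^+ 2 - (u - c) ^+ 2 * C ^+ 2).
  by rewrite /h; ring.
have -> : s ^+ 2 = u ^+ 2 - c ^+ 2 by rewrite -sc; ring.
have -> : C ^+ 2 = u ^+ 2 - D ^+ 2 by rewrite -DC; ring.
by field.
Qed.

Lemma distinct3 (n : nat) (i : 'I_n) : (3 < n)%N ->
  exists j1 j2 j3 : 'I_n,
    [/\ [/\ j1 != i, j2 != i & j3 != i] & [/\ j1 != j2, j1 != j3 & j2 != j3]].
Proof.
move=> n3; have : (2 < #|[set~ i]|)%N.
  by rewrite cardsC1 card_ord; case: n n3 i => [|n] //=.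
case/card_gt2P => j1 [j2 [j3 [[h1 h2 h3] [d1 d2 d3]]]].
exists j1, j2, j3; move: h1 h2 h3; rewrite !inE => *; split; split=> //.
by rewrite eq_sym.
Qed.

Lemma exists_follower (R : realType) (n : nat) (m : 'I_n -> R)
    (p : 'I_n -> 'rV[R]_2) (r r0 : R) (i : 'I_n) :
  (3 < n)%N -> (forall j, 0 < m j) -> injective p ->
  0 < r0 -> r0 <= r -> (forall j, dot (p j) (p j) = r ^+ 2) ->
  \sum_(j < n | j != i)
    (m j * ((enorm (p j - p i) ^+ 3)^-1 - (r0 ^+ 3)^-1)) *: (p j - p i) = 0 ->
  exists j, follows (r ^+ 2) (p i) (p j).
Proof.
move=> n3 m0 p_inj r00 r0r pr bal.
pose D j := dot (p i) (p j); pose C j := cross (p i) (p j).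
(* Since |p_j - p_i|^2 = 2 (u - D_j), the points of the circle at distance r0 from [p i] are those
   with D = c, and then C = s or C = -s. *)
pose u := r ^+ 2; pose c := u - r0 ^+ 2 / 2; pose s := Num.sqrt (u ^+ 2 - c ^+ 2).
pose S j := (enorm (p j - p i) ^+ 3)^-1 - (r0 ^+ 3)^-1.
(* Up to a positive factor, the signed distance of [p j] from the line through [p i] and the
   clockwise end of the chord. *)
pose g j := (u - c) * C j + s * (u - D j).
have r20 : 0 < r0 ^+ 2 by rewrite exprn_gt0.
have r2u : r0 ^+ 2 <= u by rewrite ler_pXn2r// nnegrE; lra.
have cu : c < u by rewrite /c; lra.
have c0 : u / 2 <= c by rewrite /c; lra.
have uc0 : 0 < u ^+ 2 - c ^+ 2 by rewrite subr_sqr; apply: mulr_gt0; lra.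
have s0 : 0 < s by rewrite sqrtr_gt0.
have sc : s ^+ 2 + c ^+ 2 = u ^+ 2 by rewrite sqr_sqrtr ?ltW// subrK.
have DC j : D j ^+ 2 + C j ^+ 2 = u ^+ 2 by rewrite sqr_dot_cross !pr expr2.
have pD j : enorm (p j - p i) ^+ 2 = 2 * (u - D j).
  rewrite sqr_enorm; transitivity (dot (p j) (p j) + dot (p i) (p i) - 2 * D j).
    by rewrite /D /dot !mxE; ring.
  by rewrite !pr /u; ring.
have d0 j : j != i -> 0 < enorm (p j - p i).
  by move=> ji; apply: enorm_gt0; rewrite subr_eq0 (inj_eq p_inj).
have Du j : j != i -> D j < u.
  by move=> /d0/(exprn_gt0 2); rewrite pD; lra.
have Sc j : j != i -> (S j <= 0) = (D j <= c).
  move=> /d0 dj; rewrite subr_le0 lef_pV2 ?posrE ?exprn_gt0//.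
  have dj0 := ltW dj; have r0_ge0 := ltW r00.
  rewrite ler_pXn2r ?nnegrE// -(@ler_pXn2r _ 2) ?nnegrE// pD /c.
  by apply/idP/idP; lra.
have Sc0 j : j != i -> S j = 0 -> D j = c.
  move=> /d0 dj /eqP; rewrite subr_eq0 (inj_eq invr_inj) => /eqP.
  move/(pexpIrn (isT : (0 < 3)%N)); rewrite !nnegrE => /(_ (ltW dj) (ltW r00)) e.
  by have := pD j; rewrite e /c; lra.
(* [g j] is a linear form in [p j - p i], so applying it to the vector balance gives a scalar
   one. *)
have bal_g : \sum_(j < n | j != i) m j * S j * g j = 0.
  have bk k : \sum_(j < n | j != i) m j * S j * (p j 0 k - p i 0 k) = 0.
    transitivity ((0 : 'rV[R]_2) 0 k); last by rewrite mxE.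
    by rewrite -bal summxE; apply: eq_bigr => j _; rewrite !mxE.
  pose F k : R := \sum_(j < n | j != i) m j * S j * (p j 0 k - p i 0 k).
  transitivity ((- (u - c) * p i 0 1 - s * p i 0 0) * F 0
      + ((u - c) * p i 0 0 - s * p i 0 1) * F 1);
    last by rewrite /F !bk !mulr0 addr0.
  rewrite /F !mulr_sumr -big_split /=; apply: eq_bigr => j _.
  by rewrite /g /C /D /u -(pr i) /cross /dot; ring.
have [/existsP[j /andP[Cj Dj]]|none] :=
    boolP [exists j, (0 < C j) && (u / 2 < D j)].
  by exists j.
(* This is where r0 <= r enters, through u / 2 <= c. A body with C = 0 is the antipode of [p i],
   where D = -u. *)
have far j : j != i -> 0 <= C j -> D j <= c.
  move=> ji Cj; have [Cj0|Cj0] := eqVneq (C j) 0.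
    by have := DC j; have := Du j ji; rewrite Cj0; nra.
  move: none; rewrite negb_exists => /forallP/(_ j).
  by rewrite lt_def Cj0 Cj /= -leNgt; lra.
(* Clockwise bodies have [g j] of the sign of c - D, opposite to that of [S j]; the others have
   [g j] > 0 and, by [far], [S j] <= 0. *)
have sgn j : j != i -> S j * g j <= 0 ?= iff (S j == 0).
  move=> ji; suff h : S j * g j <= 0 /\ (S j * g j = 0 -> S j = 0).
    case: h => h1 h2; split=> //; apply/eqP/eqP => [/h2//|->]; exact: mul0r.
  have [Cj|Cj] := ltP (C j) 0.
    have [k k0 gk] := chord_side s0 cu (Du j ji) sc (DC j) Cj.
    rewrite /g gk; split.
      have [Sj|Sj] := boolP (S j <= 0).
        rewrite mulr_le0_ge0//; move: Sj; rewrite Sc// => Dj.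
        by rewrite mulr_ge0 ?(ltW k0)// subr_ge0.
      have Sj0 : 0 <= S j by rewrite ltW// ltNge.
      rewrite mulr_ge0_le0//; move: Sj; rewrite Sc// -ltNge => Dj.
      by rewrite pmulr_rle0//; lra.
    move/eqP; rewrite !mulf_eq0 (gt_eqF k0) /= => /orP[/eqP//|].
    rewrite subr_eq0 => /eqP cD; apply/eqP; rewrite subr_eq0 (inj_eq invr_inj).
    apply/eqP; congr (_ ^+ 3); apply: (pexpIrn (isT : (0 < 2)%N));
      rewrite ?nnegrE ?enorm_ge0 ?(ltW r00)//.
    by rewrite pD -cD /c; lra.
  have g0 : 0 < g j.
    rewrite /g; apply: ltr_wpDl; first by rewrite mulr_ge0//; lra.
    by rewrite mulr_gt0// subr_gt0 Du.
  have Sj : S j <= 0 by rewrite Sc// far.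
  split; first by rewrite mulr_le0_ge0// ltW.
  by move/eqP; rewrite mulf_eq0 (gt_eqF g0) orbF => /eqP.
have S0 j : j != i -> S j = 0.
  have nonneg k : k != i -> 0 <= - (m k * S k * g k).
    by move=> ki; rewrite -mulrA oppr_ge0 pmulr_rle0 ?sgn.
  have /(psumr_eq0P nonneg) z : \sum_(k < n | k != i) - (m k * S k * g k) = 0.
    by rewrite sumrN bal_g oppr0.
  move=> ji; have /eqP := z j ji; rewrite oppr_eq0 -mulrA mulf_eq0 gt_eqF//=.
  by rewrite (sgn j ji) => /eqP.
have Dc j : j != i -> D j = c by move=> ji; exact: Sc0 (S0 j ji).
have Cs j : j != i -> C j = s \/ C j = - s.
  move=> ji; have /eqP : C j ^+ 2 = s ^+ 2 by have := DC j; rewrite Dc//; lra.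
  by rewrite eqf_sqr => /orP[]/eqP; [left|right].
have ui : 0 < dot (p i) (p i) by rewrite pr; rewrite -/u; lra.
have same j k : j != i -> k != i -> C j = C k -> j = k.
  move=> ji ki e; apply: p_inj; apply: (dot_cross_inj ui) e.
  by rewrite -/(D j) -/(D k) !Dc.
(* Only the two positions C = s and C = -s remain, so two of any three other bodies would
   coincide. *)
have [j1 [j2 [j3 [[h1 h2 h3] [d12 d13 d23]]]]] := distinct3 i n3.
case: (Cs _ h1) (Cs _ h2) (Cs _ h3) => [] e1 [] e2 [] e3; exfalso;
  by [ move/eqP: d12; apply; apply: same; rewrite ?e1
     | move/eqP: d13; apply; apply: same; rewrite ?e1
     | move/eqP: d23; apply; apply: same; rewrite ?e2].
Qed.

(** * Positivity of lambda and r0, and the balance equations *)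

Lemma total_mass_gt0 (R : realType) (n : nat) (m : 'I_n -> R) :
  (0 < n)%N -> (forall i, 0 < m i) -> 0 < total_mass m.
Proof.
case: n m => // n m _ m0; rewrite /total_mass big_ord_recl ltr_wpDr//.
by apply: sumr_ge0 => j _; exact: ltW.
Qed.

(** Two bodies at distinct positions contribute a positive term to U and cannot both sit at the
    center of mass, so I is positive too. *)
Lemma cc_lambda_gt0 (R : realType) (n : nat) (m : 'I_n -> R)
    (q : 'I_n -> 'rV[R]_2) :
  (1 < n)%N -> (forall i, 0 < m i) -> injective q -> 0 < cc_lambda m q.
Proof.
case: n m q => [|[|n]]// m q _ m0 q_inj.
have U0 : 0 < potential m q.
  have pos (i j : 'I_n.+2) : (i < j)%N -> 0 < m i * m j / enorm (q i - q j).
    move=> ij; rewrite divr_gt0 ?mulr_gt0// enorm_gt0// subr_eq0 (inj_eq q_inj).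
    by rewrite neq_ltn ij.
  have ge0 (i : 'I_n.+2) :
      0 <= \sum_(j < n.+2 | (i < j)%N) m i * m j / enorm (q i - q j).
    by apply: sumr_ge0 => j ij; rewrite ltW ?pos.
  rewrite /potential (bigD1 ord0)//= ltr_wpDr//; first exact: sumr_ge0.
  rewrite (bigD1 ord_max)//= ltr_wpDr ?pos//.
  by apply: sumr_ge0 => j /andP[ij _]; rewrite ltW ?pos.
have [k kc] : exists k, q k != center_of_mass m q.
  have [e|] := eqVneq (q ord0) (center_of_mass m q); last by exists ord0.
  by exists ord_max; rewrite -e (inj_eq q_inj).
rewrite /cc_lambda divr_gt0// /inertia (bigD1 k)//= ltr_wpDr//.
  by apply: sumr_ge0 => j _; rewrite mulr_ge0 ?sqr_ge0// ltW.
by rewrite mulr_gt0// exprn_gt0// enorm_gt0// subr_eq0.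
Qed.

(** The vectors m_j (q_j - q_i) sum to the total mass times c - q_i, so the right-hand side of the
    equations spreads over the pairs; the factor m_i then cancels. *)
Lemma central_configuration_balance (R : realType) (n : nat) (m : 'I_n -> R)
    (q : 'I_n -> 'rV[R]_2) (i : 'I_n) :
  (forall j, 0 < m j) -> central_configuration m q ->
  \sum_(j < n | j != i)
    (m j * ((enorm (q j - q i) ^+ 3)^-1 - cc_lambda m q / total_mass m))
      *: (q j - q i) = 0.
Proof.
move=> m0 cc; have M0 : 0 < total_mass m.
  by apply: total_mass_gt0 => //; apply: leq_ltn_trans (ltn_ord i).
have mi0 : m i != 0 by rewrite gt_eqF.
have bary : \sum_(j < n | j != i) m j *: (q j - q i)
          = total_mass m *: (center_of_mass m q - q i).
  transitivity (\sum_(j < n) m j *: (q j - q i)).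
    by rewrite [RHS](bigD1 i)//= subrr scaler0 add0r.
  rewrite scalerBr /center_of_mass scalerA divff ?gt_eqF// scale1r.
  rewrite /total_mass scaler_suml -sumrB; apply: eq_bigr => j _.
  by rewrite scalerBr.
apply: (scalerI mi0); rewrite scaler0 scaler_sumr.
transitivity (\sum_(j < n | j != i)
    ((m i * m j) *: ((enorm (q j - q i) ^+ 3)^-1 *: (q j - q i))
     - (m i * (cc_lambda m q / total_mass m)) *: (m j *: (q j - q i)))).
  apply: eq_bigr => j _; rewrite !scalerA -scalerBl; congr (_ *: _); ring.
rewrite sumrB cc -scaler_sumr bary scalerA.
rewrite -(mulrA (m i)) divfK ?gt_eqF// (mulrC (m i)) -[center_of_mass m q - _]opprB.
by rewrite scalerN scaleNr opprK addNr.
Qed.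

Lemma r_zero_gt0 (R : realType) (n : nat) (m : 'I_n -> R) (q : 'I_n -> 'rV[R]_2) :
  (1 < n)%N -> (forall i, 0 < m i) -> injective q -> 0 < r_zero m q.
Proof.
move=> n1 m0 q_inj; rewrite powR_gt0// divr_gt0 ?cc_lambda_gt0//.
exact/total_mass_gt0/m0/ltnW.
Qed.

(** Identifies the constant subtracted in the balance equations with r0^-3. *)
Lemma r_zero_cube (R : realType) (n : nat) (m : 'I_n -> R)
    (q : 'I_n -> 'rV[R]_2) :
  (1 < n)%N -> (forall i, 0 < m i) -> injective q ->
  (r_zero m q ^+ 3)^-1 = cc_lambda m q / total_mass m.
Proof.
move=> n1 m0 q_inj; have x0 : 0 <= total_mass m / cc_lambda m q.
  by rewrite ltW// divr_gt0 ?cc_lambda_gt0//; exact/total_mass_gt0/m0/ltnW.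
by rewrite -powR_mulrn ?powR_ge0// -powRrM mulVf ?pnatr_eq0// powRr1// invf_div.
Qed.

Unset Implicit Arguments.

Theorem proposition2 (R : realType) (n : nat)
    (m : 'I_n -> R) (q : 'I_n -> 'rV[R]_2) (o : 'rV[R]_2) (r : R)
    (n_456 : [\/ n = 4%N, n = 5%N | n = 6%N])
    (m_gt0 : forall i : 'I_n, 0 < m i)
    (q_inj : injective q)
    (cc : central_configuration m q)
    (circ : on_circle q o r) :
  r < r_zero m q.
Proof.
have /andP[n3 n6] : (3 < n <= 6)%N by case: n_456 => ->.
have n1 : (1 < n)%N by apply: leq_trans n3.
rewrite ltNge; apply/negP => r0r; case: circ => r_gt0 circ.
pose p i := q i - o.
have pr i : dot (p i) (p i) = r ^+ 2 by rewrite -sqr_enorm circ.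
have p_inj : injective p by move=> i j /addIr/q_inj.
have pB i j : p j - p i = q j - q i by rewrite /p opprB addrA subrK.
have foll i : exists j, follows (r ^+ 2) (p i) (p j).
  apply: (@exists_follower _ _ m p r (r_zero m q)) => //.
    exact: r_zero_gt0.
  rewrite r_zero_cube// -[RHS](central_configuration_balance i m_gt0 cc).
  by apply: eq_bigr => j _; rewrite pB.
(* [card_follows] needs an index type of the form ['I_n.+1], as its walk starts at [ord0]. *)
case: n => [|n] in m q n_456 m_gt0 q_inj cc circ n3 n6 n1 p r0r pr p_inj pB foll *.
  by [].
by have := card_follows (exprn_gt0 2 r_gt0) pr foll; rewrite ltnNge n6.
Qed.
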